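(* Let $U$ be a finite group and $A$ an abelian normal subgroup of $U$ containing the derived subgroup $U'$. Suppose there exists a group endomorphism $\gamma\in\mathrm{End}(U)$ such that $$A=U^{\gamma-1}U',$$ where $U^{\gamma-1}U'$ is the subgroup generated by $U'$ and the elements $\gamma(u)u^{-1}$, $u\in U$. Then the transfer $\mathrm{Ver}_{U/A}:U/U'\to A$ is trivial on the subgroup $(U/U')^{\langle\gamma\rangle}$ of elements of $U/U'$ fixed by the endomorphism of $U/U'$ induced by $\gamma$.
   Context: $\mathrm{Ver}_{U/A}$ denotes the group-theoretic transfer from $U$ to its subgroup $A$; since $A$ is abelian it is a homomorphism $U/U'\to A$. Note $U'$ is stable under $\gamma$, so $\gamma$ induces an endomorphism of $U/U'$. *)

(* Defs.v *)
From HB Require Import structures.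
From mathcomp Require Import all_boot all_order all_algebra all_fingroup all_solvable.
Set Implicit Arguments. Unset Strict Implicit. Unset Printing Implicit Defensive.

(* The transfer is meant for A \subset U (a hypothesis of the theorem).
   Transfer Ver_{U/A} : U -> A, for A an abelian subgroup of U, obtained from
   the library transfer (finmodule.v) applied to the identity morphism of A,
   and read back into gT via fmval. *)
Lemma abelian_idm_morphim (gT : finGroupType) (A : {group gT}) :
  abelian A -> abelian (idm A @* A).
Proof. by rewrite morphim_idm. Qed.

Definition Ver (gT : finGroupType) (U A : {group gT})
  (abA : abelian A) (g : gT) : gT :=
  FiniteModule.fmval (transfer U (abelian_idm_morphim abA) g).

(* Main.v *)
(** Put V = U/A and S = Z[V]. Attach to U its Artin splitting module M over S, with a crossed
    homomorphism D : U -> M such that N . D u recovers the transfer of u, where N is the norm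
    element of S. The endomorphism gamma induces an S-linear map on M;
    write T for this map minus the identity, so that T (D u) = D (gamma(u) u^-1), and view M as
    an S[X]-module with X acting as T.
    Let g_j generate U, with g_j^(m_j) in A and \prod_j m_j = |U : A|. Since A is generated by U'
    and the gamma(u) u^-1, expanding D (g_j^(m_j)) in two ways gives a square relation matrix mu
    over S[X] for the vector e = (D g_j)_j. At X = 0 its determinant kills the augmentation ideal
    and has augmentation |V|, hence equals N; so det mu = N + X lam.
    If gamma(u) u^-1 lies in U', then T (D u) = beta . e with beta over the augmentation ideal,
    and beta . adj mu vanishes at X = 0 for the same reason. Dividing beta . adj mu . mu =
    det mu . beta = X lam beta by X gives lam beta = nu . mu, hence lam T (D u) = lam beta . e = 0
    and N (D u) = det mu (D u) - lam T (D u) = 0. *)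
Require Import Defs.
From HB Require Import structures.
From mathcomp Require Import all_boot all_order all_algebra all_fingroup all_solvable.

Set Implicit Arguments. Unset Strict Implicit. Unset Printing Implicit Defensive.
Import GRing.Theory Num.Theory FinRing.Theory.
Local Open Scope ring_scope.

(** * The integral group ring of a finite additive group and its invariants *)

Definition group_ring (V : finZmodType) := {ffun V -> int}.
HB.instance Definition _ (V : finZmodType) :=
  GRing.Zmodule.copy (group_ring V) {ffun V -> int}.

Section GroupRing.

Variable V : finZmodType.
Local Notation S := (group_ring V).
Implicit Types (r s : S) (v w : V).

Definition gr_delta v : S := [ffun w => (w == v)%:R].
Definition gr_mul r s : S := [ffun v => \sum_w r w * s (v - w)].
Definition gr_aug r : int := \sum_v r v.
Definition gr_norm : S := [ffun => 1].

Fact gr_mulA : associative gr_mul.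
Proof.
move=> r s t; apply/ffunP=> v; rewrite !ffunE.
under eq_bigr => w _ do rewrite ffunE big_distrr /=.
under [RHS]eq_bigr => w _ do rewrite ffunE big_distrl /=.
rewrite [RHS]exchange_big /=; apply: eq_bigr => w _.
rewrite [RHS](reindex_inj (addrI w)) /=; apply: eq_bigr => x _.
by rewrite mulrA (addrC w x) addrK opprD addrA (addrAC v (- x)).
Qed.

Fact gr_mulC : commutative gr_mul.
Proof.
move=> r s; apply/ffunP=> v; rewrite !ffunE (reindex_inj (can_inj (subKr v))) /=.
by apply: eq_bigr => w _; rewrite subKr mulrC.
Qed.

Lemma gr_delta_mulE v r w : gr_mul (gr_delta v) r w = r (w - v).
Proof.
rewrite ffunE (bigD1 v) //= ffunE eqxx mul1r big1 ?addr0 // => x /negPf nxv.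
by rewrite ffunE nxv mul0r.
Qed.

Fact gr_mul1 : left_id (gr_delta 0) gr_mul.
Proof. by move=> r; apply/ffunP=> v; rewrite gr_delta_mulE subr0. Qed.

Fact gr_mulDl : left_distributive gr_mul +%R.
Proof.
move=> r s t; apply/ffunP=> v; rewrite !ffunE -big_split /=.
by apply: eq_bigr => w _; rewrite ffunE mulrDl.
Qed.

Fact gr_oner_neq0 : gr_delta 0 != 0.
Proof. by apply/eqP=> /ffunP/(_ 0); rewrite !ffunE eqxx. Qed.

HB.instance Definition _ := GRing.Zmodule_isComNzRing.Build (group_ring V)
  gr_mulA gr_mulC gr_mul1 gr_mulDl gr_oner_neq0.

Lemma gr_delta0 : gr_delta 0 = 1. Proof. by []. Qed.

Lemma gr_deltaD v w : gr_delta (v + w) = gr_delta v * gr_delta w.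
Proof.
by apply/ffunP=> x; rewrite [RHS]gr_delta_mulE !ffunE subr_eq addrC.
Qed.

Lemma gr_deltaMn v n : gr_delta (v *+ n) = gr_delta v ^+ n.
Proof. by elim: n => // n IHn; rewrite mulrS exprS gr_deltaD IHn. Qed.

Fact gr_aug_additive : zmod_morphism gr_aug.
Proof.
by move=> r s; rewrite /gr_aug -sumrB; apply: eq_bigr => v _; rewrite !ffunE.
Qed.

Lemma gr_aug_delta v : gr_aug (gr_delta v) = 1.
Proof.
rewrite /gr_aug (bigD1 v) //= ffunE eqxx big1 ?addr0 // => x /negPf nxv.
by rewrite ffunE nxv.
Qed.

Fact gr_aug_multiplicative : monoid_morphism gr_aug.
Proof.
split=> [|r s]; first exact: gr_aug_delta.
rewrite /gr_aug; under eq_bigr => v _ do rewrite ffunE.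
rewrite exchange_big big_distrl /=; apply: eq_bigr => w _.
by rewrite -big_distrr /= [in RHS](reindex_inj (addIr (- w))).
Qed.

HB.instance Definition _ := GRing.isZmodMorphism.Build S int gr_aug gr_aug_additive.
HB.instance Definition _ :=
  GRing.isMonoidMorphism.Build S int gr_aug gr_aug_multiplicative.

Lemma gr_norm_delta v : gr_norm * gr_delta v = gr_norm.
Proof. by rewrite mulrC; apply/ffunP=> w; rewrite [LHS]gr_delta_mulE !ffunE. Qed.

Lemma gr_aug_norm : gr_aug gr_norm = #|V|%:R.
Proof. by rewrite /gr_aug; under eq_bigr => v _ do rewrite ffunE; rewrite sumr_const. Qed.

Lemma gr_invariantE r : (forall v, r * (gr_delta v - 1) = 0) -> forall v, r v = r 0.
Proof.
move=> inv_r v; have /eqP := inv_r (- v).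
rewrite mulrBr mulr1 subr_eq0 mulrC => /eqP/ffunP/(_ 0).
by rewrite [LHS]gr_delta_mulE sub0r opprK.
Qed.

(** An invariant element is an integer multiple c of the norm element and has augmentation c|V|; as
    |V| is nonzero, the augmentation determines c. *)
Lemma gr_invariant_inj r s :
    (forall v, r * (gr_delta v - 1) = 0) -> (forall v, s * (gr_delta v - 1) = 0) ->
  gr_aug r = gr_aug s -> r = s.
Proof.
have augE t : (forall v, t * (gr_delta v - 1) = 0) -> gr_aug t = t 0 *+ #|V|.
  move=> inv_t; rewrite -sumr_const.
  by apply: eq_bigr => v _; rewrite [LHS]gr_invariantE.
move=> inv_r inv_s; rewrite !augE // => eq_rs; apply/ffunP=> v.
rewrite (gr_invariantE inv_r) (gr_invariantE inv_s); apply/eqP.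
move/eqP: eq_rs; rewrite -subr_eq0 -mulrnBl mulrn_eq0 subr_eq0.
by rewrite (cardD1 (0 : V)) inE.
Qed.

End GroupRing.


(** * The S[X]-module defined by a linear endomorphism *)

(* M as a module over S[X], with X acting as tau. *)
Definition polymod (S : comNzRingType) (M : lmodType S) of {linear M -> M} : Type := M.
HB.instance Definition _ (S : comNzRingType) (M : lmodType S) (tau : {linear M -> M}) :=
  GRing.Zmodule.copy (polymod tau) M.

Section PolyAction.

Variables (S : comNzRingType) (M : lmodType S) (tau : {linear M -> M}).
Implicit Types (p q : {poly S}) (u v : polymod tau) (a : S).

Definition poly_act p v : polymod tau :=
  \sum_(i < size p) p`_i *: (iter i tau v : M).

Lemma poly_act_widen n p v : (size p <= n)%N ->
  poly_act p v = \sum_(i < n) p`_i *: (iter i tau v : M).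
Proof.
move=> le_p_n; rewrite /poly_act (big_ord_widen n (fun i => p`_i *: (iter i tau v : M))) //.
rewrite big_mkcond; apply: eq_bigr => i _; case: ltnP => // le_p_i.
by rewrite nth_default // scale0r.
Qed.

Fact poly_actDl v : {morph poly_act^~ v : p q / p + q}.
Proof.
move=> p q; pose n := maxn (size p) (size q).
rewrite !(@poly_act_widen n) ?leq_maxl ?leq_maxr ?size_polyD // -big_split /=.
by apply: eq_bigr => i _; rewrite coefD scalerDl.
Qed.

Fact poly_actDr : right_distributive poly_act +%R.
Proof.
move=> p u v; rewrite /poly_act -big_split; apply: eq_bigr => i _ /=.
rewrite -scalerDr; congr (_ *: _).
by elim: (i : nat) => //= k ->; rewrite linearD.
Qed.

Lemma poly_actC a v : poly_act a%:P v = a *: (v : M).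
Proof. by rewrite (poly_act_widen _ (size_polyC_leq1 a)) big_ord1 coefC. Qed.

Fact poly_act1 : left_id 1 poly_act.
Proof. by move=> v; rewrite poly_actC scale1r. Qed.

Lemma poly_actMX p v : poly_act (p * 'X) v = poly_act p (tau v).
Proof.
rewrite (@poly_act_widen (size p).+1); last first.
  by rewrite (leq_trans (size_polyMleq _ _)) // size_polyX addn2.
rewrite big_ord_recl coefMX scale0r add0r; apply: eq_bigr => i _.
by rewrite coefMX /= -iterSr.
Qed.

Lemma poly_act_tau p v : poly_act p (tau v) = tau (poly_act p v).
Proof.
rewrite /poly_act linear_sum; apply: eq_bigr => i _.
by rewrite linearZ -iterS iterSr.
Qed.

Lemma poly_actMC p a v : poly_act (a%:P * p) v = a *: (poly_act p v : M).
Proof.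
rewrite (@poly_act_widen (size p)); last by rewrite mul_polyC size_scale_leq.
by rewrite scaler_sumr; apply: eq_bigr => i _; rewrite coefCM scalerA.
Qed.

Fact poly_actA p q v : poly_act p (poly_act q v) = poly_act (p * q) v.
Proof.
elim/poly_ind: p v => [|p a IHp] v.
  by rewrite mul0r /poly_act size_poly0 !big_ord0.
rewrite mulrDl !poly_actDl mulrAC poly_actMC poly_actC !poly_actMX -IHp.
by congr (poly_act p _ + _); rewrite poly_act_tau.
Qed.

HB.instance Definition _ := GRing.Zmodule_isLmodule.Build {poly S} (polymod tau)
  poly_actA poly_act1 poly_actDr poly_actDl.

Lemma polymodCE a v : a%:P *: v = a *: (v : M).
Proof. exact: poly_actC. Qed.

Lemma polymodXE v : 'X *: v = tau v.
Proof. by rewrite -[LHS]/(poly_act _ _) -[X in poly_act X]mul1r poly_actMX poly_act1. Qed.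

End PolyAction.

(** Turns vanishing at X = 0 into divisibility by X. *)
Lemma horner0_split (S : comNzRingType) (p : {poly S}) :
  exists q, p = (p.[0])%:P + 'X * q.
Proof.
elim/poly_ind: p => [|p a _]; first by exists 0; rewrite horner0 mulr0 addr0.
by exists p; rewrite !hornerE addrC mulrC.
Qed.

(** * Adjugates, determinants and division by X *)

Section Determinant.

Variables (S : comNzRingType) (n : nat).

(* Both adj mu . mu = det mu and the vanishing of beta . adj mu at X = 0 can be divided by X,
   because X is regular. *)
Lemma adj_divX (mu : 'M[{poly S}]_n) (beta : 'rV[S]_n) (N : S)
    (mu0 := map_mx (horner_eval 0) mu) :
    \det mu0 = N -> beta *m \adj mu0 = 0 -> N *: beta = 0 ->
  exists lam (nu : 'rV_n),
    \det mu = N%:P + 'X * lam /\ lam *: map_mx polyC beta = nu *m mu.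
Proof.
move=> det_mu0 beta_adj N_beta; set betaP := map_mx polyC beta.
have [lam] := horner0_split (\det mu).
rewrite -horner_evalE -det_map_mx -/mu0 det_mu0 => det_mu.
have w_divX j : exists q, (betaP *m \adj mu) 0 j = 'X * q.
  have [q ->] := horner0_split ((betaP *m \adj mu) 0 j).
  exists q; rewrite -[X in X + _ = _]/((_.[0])%:P) -horner_evalE.
  have: map_mx (horner_eval 0) (betaP *m \adj mu) = 0.
    rewrite map_mxM map_mx_adj -/mu0 -map_mx_comp -[RHS]beta_adj; congr (_ *m _).
    by apply/rowP=> k; rewrite !mxE /= horner_evalE hornerC.
  by move/rowP/(_ j); rewrite !mxE => ->; rewrite add0r.
have [nu nuE] := fin_all_exists w_divX.
have X_lreg : GRing.lreg ('X : {poly S}) by apply/monic_lreg/monicX.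
exists lam, (\row_j nu j); split=> //.
(* Both sides equal [betaP *m \adj mu *m mu]: on the left, [N *: beta = 0] removes the constant term
   of [\det mu]. *)
have: 'X *: (lam *: betaP) = 'X *: (\row_j nu j *m mu).
  have -> : 'X *: (lam *: betaP) = \det mu *: betaP.
    rewrite det_mu scalerDl scalerA -[LHS]add0r; congr (_ + _).
    by apply/rowP=> j; have/rowP/(_ j) := N_beta; rewrite !mxE -polyCM => ->.
  rewrite -[LHS]mul_mx_scalar -mul_adj_mx mulmxA scalemxAl; congr (_ *m _).
  by apply/rowP=> j; rewrite nuE !mxE.
by move/rowP=> eqX; apply/rowP=> j; have := eqX j; rewrite !mxE => /X_lreg.
Qed.

(** The cofactors along row k do not involve row k. The matrix on the right kills every vector
    killed by both [mu] and [beta], so [det_kernel] applies to it. *)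
Lemma det_replace_row (mu : 'M[S]_n) (beta : 'rV[S]_n) k :
  (beta *m \adj mu) 0 k = \det (\matrix_i (if i == k then beta else row i mu)).
Proof.
set B := \matrix_i _; rewrite (expand_det_row B k) mxE; apply: eq_bigr => j _.
rewrite !mxE eqxx; congr (_ * (_ * \det _)).
by apply/matrixP=> i l; rewrite !mxE eq_sym (negPf (neq_lift k i)) mxE.
Qed.

Lemma det_kernel (mu : 'M[S]_n) (h : 'cV[S]_n) j : mu *m h = 0 -> \det mu * h j 0 = 0.
Proof.
move=> mu_h; have: \adj mu *m (mu *m h) = 0 by rewrite mu_h mulmx0.
by rewrite mulmxA mul_adj_mx mul_scalar_mx => /colP/(_ j); rewrite !mxE.
Qed.

End Determinant.

(** * Annihilation by the norm element from a relation matrix *)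

Section Kernel.

Variables (V : finZmodType) (n : nat).
Local Notation S := (group_ring V).
Variables (M : lmodType S) (tau : {linear M -> M}) (pr : {linear M -> S^o}).
Hypothesis pr_tau : forall x, pr (tau x) = 0.
Variables (e : 'I_n -> M).
(** Satisfied when the [pr (e j)] generate the augmentation ideal; it is stated through
    annihilators, the form in which determinants meet it. *)
Hypothesis pr_e_gen :
  forall r : S, (forall j, r * pr (e j) = 0) -> forall v, r * (gr_delta v - 1) = 0.

Local Notation MX := (polymod tau).

Lemma pr_poly_act (p : {poly S}) (x : MX) : pr (p *: x : MX) = p.[0] * pr x.
Proof.
have [q ->] := horner0_split p.
rewrite scalerDl -scalerA polymodCE polymodXE.
rewrite raddfD /= pr_tau addr0 linearZ.
by rewrite !hornerE.
Qed.

Lemma norm_annihilates (mu : 'M[{poly S}]_n) (xi beta : 'rV[S]_n) (x : M) :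
    (forall i, \sum_j mu i j *: (e j : MX) = 0 :> MX) ->
    gr_aug (\det (map_mx (horner_eval 0) mu)) = #|V|%:R ->
    x = \sum_j xi 0 j *: e j ->
    (forall j, gr_aug (beta 0 j) = 0) ->
    tau x = \sum_j beta 0 j *: e j ->
  gr_norm V *: x = 0.
Proof.
move=> mu_e aug_det def_x aug_beta tau_x; set mu0 := map_mx _ mu in aug_det.
(* Since [pr] kills the image of [tau], applying it to a relation over S[X] evaluates the
   coefficients at X = 0; thus [h] lies in the kernel of [mu0]. *)
pose h : 'cV[S]_n := \col_j pr (e j).
have mu0_h : mu0 *m h = 0.
  apply/colP=> i; rewrite !mxE; have /(congr1 pr) := mu_e i.
  rewrite raddf0 raddf_sum => {2}<-; apply: eq_bigr => j _.
  by rewrite !mxE -pr_poly_act.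
have beta_h : beta *m h = 0.
  apply/rowP=> i; rewrite !mxE; have /(congr1 pr) := tau_x.
  rewrite pr_tau raddf_sum => {2}->; apply: eq_bigr => j _.
  by rewrite !mxE /= linearZ.
(* By Cramer's rule [\det A] kills every [pr (e j)], hence the augmentation ideal. *)
have invariant_det (A : 'M[S]_n) : A *m h = 0 -> forall v, \det A * (gr_delta v - 1) = 0.
  move=> A_h; apply: pr_e_gen => j.
  by have := det_kernel j A_h; rewrite mxE.
have inv_norm v : gr_norm V * (gr_delta v - 1) = 0.
  by rewrite mulrBr mulr1 gr_norm_delta subrr.
have det_mu0 : \det mu0 = gr_norm V.
  by apply: gr_invariant_inj => //; [apply: invariant_det | rewrite gr_aug_norm].
have norm_beta : gr_norm V *: beta = 0.
  apply/rowP=> j; rewrite !mxE; apply: gr_invariant_inj.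
  - by move=> v; rewrite mulrAC inv_norm mul0r.
  - by move=> v; rewrite mul0r.
  by rewrite rmorphM /= aug_beta mulr0 rmorph0.
have beta_adj : beta *m \adj mu0 = 0.
  apply/rowP=> k; rewrite [RHS]mxE; apply: gr_invariant_inj.
  (* Putting [beta] in place of a row of [mu0] keeps [h] in the kernel, so each entry is invariant;
     its augmentation is 0 because that of every entry of [beta] is. *)
  - rewrite det_replace_row; apply: invariant_det; apply/row_matrixP=> i.
    rewrite row_mul rowK; case: eqP => _; first by rewrite beta_h row0.
    by rewrite -row_mul mu0_h.
  - by move=> v; rewrite mul0r.
  rewrite mxE rmorph0 rmorph_sum big1 // => j _.
  by rewrite rmorphM /= aug_beta mul0r.
have [lam [nu [det_mu lam_beta]]] := adj_divX det_mu0 beta_adj norm_beta.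
have mul_mu_e (r : 'rV_n) : \sum_j (r *m mu) 0 j *: (e j : MX) = 0 :> MX.
  under eq_bigr => j _ do rewrite mxE scaler_suml.
  rewrite exchange_big big1 //= => i _.
  rewrite -[RHS](scaler0 _ (r 0 i)) -[in RHS](mu_e i) scaler_sumr.
  by apply: eq_bigr => j _; rewrite scalerA.
have det_x : \det mu *: (x : MX) = 0.
  rewrite def_x -[RHS](mul_mu_e (map_mx polyC xi *m \adj mu)) -mulmxA mul_adj_mx mul_mx_scalar.
  rewrite scaler_sumr; apply: eq_bigr => j _.
  by rewrite !mxE -scalerA polymodCE.
have lam_tau_x : lam *: (tau x : MX) = 0.
  rewrite tau_x -[RHS](mul_mu_e nu) -lam_beta scaler_sumr; apply: eq_bigr => j _.
  by rewrite !mxE -scalerA polymodCE.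
move: det_x; rewrite det_mu scalerDl polymodCE mulrC -scalerA polymodXE lam_tau_x.
by rewrite addr0.
Qed.

End Kernel.

(** In a finite group the generated subgroup consists of products of generators, so there is no case
    for inverses. [P] takes values in Prop to allow existential statements. *)
Lemma gen_ind (gT : finGroupType) (B : {set gT}) (P : gT -> Prop) :
    P 1%g -> (forall x, x \in B -> P x) ->
    {in <<B>>%g &, forall x y, P x -> P y -> P (x * y)%g} ->
  {in <<B>>%g, forall x, P x}.
Proof.
move=> P1 PB PM _ /gen_prodgP[n [c Bc ->]].
pose Q x := x \in <<B>>%g /\ P x.
suff [] : Q (\prod_i c i)%g by [].
elim/big_ind: _ => [|x y [Bx Px] [By Py]|i _]; first by split.
  by split; [exact: groupM | exact: PM].
by split; [exact: mem_gen | exact: PB].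
Qed.

(** * Crossed homomorphisms and the square relation matrix *)

Section CrossedHom.

Variables (gT : finGroupType) (U A : {group gT}) (V : finZmodType).
Local Notation S := (group_ring V).
Variables (M : lmodType S) (tau : {linear M -> M}) (pr : {linear M -> S^o}).
Variables (pi : gT -> V) (D : gT -> M) (gam : gT -> gT).

Hypotheses (sAU : A \subset U) (sU'A : U^`(1)%g \subset A).
Hypothesis piM : {in U &, {morph pi : x y / (x * y)%g >-> x + y}}.
Hypothesis piA : {in A, forall a, pi a = 0}.
Hypothesis pi_surj : forall v, exists2 x, x \in U & pi x = v.
Hypothesis DM : {in U &, forall x y, D (x * y)%g = D x + gr_delta (pi x) *: D y}.
Hypothesis prD : {in U, forall x, pr (D x) = gr_delta (pi x) - 1}.
Hypothesis pr_tau : forall x, pr (tau x) = 0.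
Hypothesis tauD : {in U, forall x, tau (D x) = D (gam x * x^-1)%g}.
Hypothesis defA : A :=: << U^`(1) :|: [set gam u * u^-1 | u in U] >>%g.

Variables (n : nat) (g : 'I_n -> gT) (m : 'I_n -> nat).
Hypothesis genU : U :=: << [set g j | j : 'I_n] >>%g.
Hypothesis gmA : forall j, (g j ^+ m j)%g \in A.
Hypothesis prod_m : (\prod_j m j = #|V|)%N.

Let Ug j : g j \in U. Proof. by rewrite genU mem_gen ?imset_f. Qed.

Let comb (c : 'rV[S]_n) : M := \sum_j c 0 j *: D (g j).

Let combD b c : comb (b + c) = comb b + comb c.
Proof. by rewrite /comb -big_split; apply: eq_bigr => j _; rewrite mxE scalerDl. Qed.

Let combB b c : comb (b - c) = comb b - comb c.
Proof. by rewrite /comb -sumrB; apply: eq_bigr => j _; rewrite !mxE scalerBl. Qed.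

Let combZ r c : comb (r *: c) = r *: comb c.
Proof. by rewrite /comb scaler_sumr; apply: eq_bigr => j _; rewrite mxE scalerA. Qed.

Let comb0 : comb 0 = 0.
Proof. by rewrite /comb big1 // => j _; rewrite mxE scale0r. Qed.

Let comb_delta i : comb (delta_mx 0 i) = D (g i).
Proof.
rewrite /comb (bigD1 i) //= mxE !eqxx scale1r big1 ?addr0 // => j /negPf ne_ji.
by rewrite mxE ne_ji scale0r.
Qed.

Let aug0 (b : 'rV[S]_n) := map_mx (@gr_aug V) b = 0.

Let D1 : D 1%g = 0.
Proof.
have := DM (group1 U) (group1 U); rewrite mulg1 piA ?group1 // scale1r.
by move/eqP; rewrite -subr_eq subrr => /eqP.
Qed.

Let DMA : {in A & U, forall a x, D (a * x)%g = D a + D x}.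
Proof. by move=> a x Aa Ux; rewrite DM ?(subsetP sAU a) // piA ?scale1r. Qed.

Let D_comb : {in U, forall x, exists c, D x = comb c}.
Proof.
rewrite {1}genU; apply: gen_ind.
- by exists 0; rewrite D1 comb0.
- by move=> _ /imsetP[j _ ->]; exists (delta_mx 0 j); rewrite comb_delta.
rewrite -genU => x y Ux Uy [b Db] [c Dc].
by exists (b + gr_delta (pi x) *: c); rewrite DM // combD combZ Db Dc.
Qed.

(** Expanding [D] on xy = yx[x,y] gives yx.D[x,y] = (x-1).D y - (y-1).D x, with coefficients in the
    augmentation ideal. Products cause no trouble, since [D] is additive on A. *)
Let D_der : {in U^`(1)%g, forall x, exists2 b, aug0 b & D x = comb b}.
Proof.
rewrite derg1; apply: gen_ind.
- by exists 0; rewrite ?D1 ?comb0 // /aug0 map_mx0.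
- move=> _ /imset2P[x y Ux Uy ->]; have [b Db] := D_comb Ux; have [c Dc] := D_comb Uy.
  have Dxy : D (y * x * [~ x, y])%g = D (x * y)%g.
    by rewrite -commgC.
  exists (gr_delta (- pi (y * x)%g) *:
            ((gr_delta (pi x) - 1) *: c - (gr_delta (pi y) - 1) *: b)).
    apply/rowP=> j; rewrite !mxE rmorphM rmorphB !rmorphM !rmorphB /= !gr_aug_delta.
    by rewrite !subrr !mul0r subrr mulr0.
  have Uxy : [~ x, y]%g \in U by rewrite groupR.
  have -> : D [~ x, y]%g = gr_delta (- pi (y * x)%g) *: (D (x * y)%g - D (y * x)%g).
    rewrite -Dxy (DM (groupM Uy Ux) Uxy) addrAC subrr add0r scalerA -gr_deltaD.
    by rewrite addNr scale1r.
  rewrite combZ combB !combZ -Db -Dc !DM // !scalerBl !scale1r.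
  by rewrite opprD opprB (addrC (D x)) addrACA.
rewrite -/[~: U, U]%g -derg1 => x y /(subsetP sU'A) Ax /(subsetP sU'A) Ay [b aug_b Db] [c aug_c Dc].
exists (b + c); first by rewrite /aug0 map_mxD aug_b aug_c addr0.
by rewrite DMA ?(subsetP sAU y) // combD Db Dc.
Qed.

(** The two kinds of generators of A supply the two terms: gamma(u) u^-1 gives [tau (D u)], and U'
    gives coefficients of augmentation 0. *)
Let D_A : {in A, forall a, exists c, exists2 b, aug0 b & D a = tau (comb c) + comb b}.
Proof.
rewrite {1}defA; apply: gen_ind.
- by exists 0, 0; rewrite ?D1 ?comb0 ?linear0 ?addr0 // /aug0 map_mx0.
- move=> a /setUP[/D_der[b aug_b Db]|/imsetP[u Uu ->]].
    by exists 0, b; rewrite ?comb0 ?linear0 ?add0r.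
  have [c Dc] := D_comb Uu; exists c, 0; first by rewrite /aug0 map_mx0.
  by rewrite -tauD // Dc comb0 addr0.
rewrite -defA => x y Ax Ay [c [b aug_b Db]] [c' [b' aug_b' Db']].
exists (c + c'), (b + b'); first by rewrite /aug0 map_mxD aug_b aug_b' addr0.
by rewrite DMA ?(subsetP sAU y) // !combD linearD Db Db' addrACA.
Qed.

Let DX x k : x \in U -> D (x ^+ k)%g = (\sum_(l < k) gr_delta (pi x) ^+ l) *: D x.
Proof.
move=> Ux; elim: k => [|k IHk]; first by rewrite D1 big_ord0 scale0r.
rewrite expgSr DM ?groupX // IHk big_ord_recr /= scalerDl -gr_deltaMn.
congr (_ + gr_delta _ *: _); elim: k {IHk} => [|k IHk]; first by rewrite piA ?group1.
by rewrite expgSr piM ?groupX // IHk mulrSr.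
Qed.

Lemma norm_fixed x : x \in U -> (gam x * x^-1)%g \in U^`(1)%g -> gr_norm V *: D x = 0.
Proof.
move=> Ux /D_der[beta /rowP aug_beta D_beta]; rewrite -tauD // in D_beta.
have [xi D_xi] := D_comb Ux.
have [c /fin_all_exists2[b aug_b Dgm]] := fin_all_exists (fun j => D_A (gmA j)).
pose norm_g j := \sum_(l < m j) gr_delta (pi (g j)) ^+ l.
(* Row i equates two values of [D (g i ^+ m i)]: the geometric sum [norm_g i] times [D (g i)], and
   the expression from [D_A], where [tau] is the action of X. *)
pose mu : 'M[{poly S}]_n :=
  \matrix_(i, j) ((norm_g i *+ (i == j) - b i 0 j)%:P - (c i 0 j)%:P * 'X).
apply: (@norm_annihilates _ _ _ tau pr pr_tau (D \o g) _ mu xi beta) => //=.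
- move=> r r_g v; have [y Uy <-] := pi_surj v; have [d Dd] := D_comb Uy.
  rewrite -prD // Dd raddf_sum mulr_sumr big1 // => j _.
  by rewrite /= linearZ /= mulrCA r_g mulr0.
- move=> i; transitivity (comb (norm_g i *: delta_mx 0 i - b i) - tau (comb (c i))).
    rewrite [tau _]linear_sum -sumrB; apply: eq_bigr => j _ /=.
    rewrite !mxE eqxx andTb mulr_natr eq_sym scalerBl -scalerA polymodXE !polymodCE.
    by rewrite linearZ.
  by rewrite combB combZ comb_delta -DX // Dgm addrK subrr.
- rewrite -det_map_mx -map_mx_comp.
  (* At X = 0 the [c] terms vanish, augmentation kills the [b] terms, and [norm_g i] has [m i]
     summands of augmentation 1. *)
  have -> : map_mx (@gr_aug V \o horner_eval 0) mu = diag_mx (\row_j (m j)%:R).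
    apply/matrixP=> i j; rewrite !mxE /= horner_evalE !hornerE subr0 rmorphB rmorphMn /=.
    have /rowP/(_ j) := aug_b i; rewrite !mxE => ->; rewrite subr0 rmorph_sum /=.
    under eq_bigr => l _ do rewrite rmorphXn /= gr_aug_delta expr1n.
    by rewrite sumr_const card_ord.
  by rewrite det_diag -prod_m natr_prod; apply: eq_bigr => j _; rewrite mxE.
by move=> j; have := aug_beta j; rewrite !mxE.
Qed.

End CrossedHom.

(** * The coinduced module Map(V, B), with V acting by translation *)

Definition coind (V : finZmodType) (B : zmodType) := {ffun V -> B}.
HB.instance Definition _ (V : finZmodType) (B : zmodType) :=
  GRing.Zmodule.copy (coind V B) {ffun V -> B}.

Section Coinduced.

Variables (V : finZmodType) (B : zmodType).
Local Notation S := (group_ring V).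
Implicit Types (r s : S) (f : coind V B).

Definition coind_scale r f : coind V B := [ffun v => \sum_w f (v + w) *~ r w].

Fact coind_scaleA r s f : coind_scale r (coind_scale s f) = coind_scale (r * s) f.
Proof.
apply/ffunP=> v; rewrite !ffunE.
under eq_bigr => w _ do rewrite ffunE mulrz_suml.
under [RHS]eq_bigr => w _ do rewrite ffunE mulrz_sumr.
rewrite [RHS]exchange_big; apply: eq_bigr => w _ /=.
rewrite [RHS](reindex_inj (addrI w)) /=; apply: eq_bigr => x _.
by rewrite mulrC mulrzA addrA (addrC w x) addrK.
Qed.

Lemma coind_scale_delta v f w : coind_scale (gr_delta v) f w = f (w + v).
Proof.
rewrite ffunE (bigD1 v) //= ffunE eqxx mulr1z big1 ?addr0 // => x /negPf nxv.
by rewrite ffunE nxv mulr0z.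
Qed.

Fact coind_scale1 : left_id 1 coind_scale.
Proof. by move=> f; apply/ffunP=> v; rewrite coind_scale_delta addr0. Qed.

Fact coind_scaleDr : right_distributive coind_scale +%R.
Proof.
move=> r f h; apply/ffunP=> v; rewrite !ffunE -big_split.
by apply: eq_bigr => w _; rewrite ffunE mulrzDl.
Qed.

Fact coind_scaleDl f : {morph coind_scale^~ f : r s / r + s}.
Proof.
move=> r s; apply/ffunP=> v; rewrite !ffunE -big_split.
by apply: eq_bigr => w _; rewrite ffunE mulrzDr.
Qed.

HB.instance Definition _ := GRing.Zmodule_isLmodule.Build S (coind V B)
  coind_scaleA coind_scale1 coind_scaleDr coind_scaleDl.

Lemma coind_deltaE v f w : (gr_delta v *: f) w = f (w + v).
Proof. exact: coind_scale_delta. Qed.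

(** This is how the transfer, a sum over all cosets, becomes multiplication by the norm element. *)
Lemma coind_normE f v : (gr_norm V *: f) v = \sum_w f w.
Proof.
rewrite ffunE [RHS](reindex_inj (addrI v)) /=.
by apply: eq_bigr => w _; rewrite ffunE mulr1z.
Qed.

End Coinduced.

(** Lift the generators of a cyclic decomposition of U/A, with their orders as exponents. To
    generate U as well, adjoin all elements of A with exponent 1, which leaves the product of the
    exponents unchanged. *)
Lemma exists_generators_index (gT : finGroupType) (U A : {group gT}) :
    (A <| U)%g -> abelian (U / A)%g ->
  exists n (g : 'I_n -> gT) (m : 'I_n -> nat),
    [/\ U :=: <<[set g j | j : 'I_n]>>%g, forall j, (g j ^+ m j)%g \in A
      & (\prod_j m j = #|(U / A)%g|)%N].
Proof.
move=> nsAU abUA; have [sAU nAU] := andP nsAU.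
have [b defUA _] := abelian_structure abUA.
have Ub x : x \in b -> x \in (U / A)%g.
  move=> bx; rewrite -(bigdprodWY defUA) mem_gen //.
  elim: b bx {defUA} => // y b IHb; rewrite inE big_cons.
  by case/predU1P=> [-> | /IHb bx]; rewrite inE ?cycle_id ?bx ?orbT.
pose l := [seq (repr (x : coset_of A), #[x]) | x <- b]%g ++ [seq (a, 1%N) | a <- enum A].
have lP p : p \in l -> p.1 \in U /\ (p.1 ^+ p.2)%g \in A.
  rewrite mem_cat => /orP[/mapP[x bx ->] | /mapP[a Aa ->]] /=; last first.
    by rewrite mem_enum in Aa; rewrite expg1 (subsetP sAU).
  have nAx : repr x \in 'N(A)%g by apply: repr_coset_norm.
  split.
    have /morphimP[y Ny Uy def_x] := Ub x bx.
    have : repr x \in (A :* y)%g by rewrite -(val_coset Ny) -[coset _ y]def_x mem_repr_coset.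
    by case/rcosetP=> a Aa ->; rewrite groupM // (subsetP sAU).
  apply: coset_idr; first exact: groupX.
  by rewrite morphX //= coset_reprK expg_order.
exists (size l), (fun j => (nth (1%g, 1%N) l j).1), (fun j => (nth (1%g, 1%N) l j).2).
set H := <<_>>%g.
have lH p : p \in l -> p.1 \in H.
  move=> lp; rewrite mem_gen //; apply/imsetP.
  by have /(nthP (1%g, 1%N))[j lt_j <-] := lp; exists (Ordinal lt_j).
split.
- apply/eqP; rewrite eqEsubset gen_subG; apply/andP; split; last first.
    by apply/subsetP=> _ /imsetP[j _ ->]; have [] := lP _ (mem_nth (1%g, 1%N) (ltn_ord j)).
  have sAH : A \subset H.
    apply/subsetP=> a Aa; apply: (lH (a, 1%N)); rewrite mem_cat orbC map_f //.
    by rewrite mem_enum.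
  (* As the generated group contains A, it is enough to cover U/A. *)
  rewrite -(quotientSGK nAU sAH) -(bigdprodWY defUA) gen_subG.
  rewrite big_seq; elim/big_ind: _ => [|X Y sXH sYH|x bx]; first exact: sub0set.
    by rewrite subUset sXH.
  rewrite cycle_subG -(coset_reprK x) mem_quotient //.
  by apply: (lH (repr x, #[x]%g)); rewrite mem_cat map_f.
- by move=> j; have [] := lP _ (mem_nth (1%g, 1%N) (ltn_ord j)).
rewrite -(big_mkord xpredT (fun j => (nth (1%g, 1%N) l j).2)) -(big_nth (1%g, 1%N) xpredT snd).
rewrite big_cat !big_map /= [X in (_ * X)%N]big1 // muln1.
exact: bigdprod_card defUA.
Qed.

(** * The transfer as a crossed homomorphism, and the action of gamma *)

Section Transfer.

Variables (gT : finGroupType) (U A : {group gT}).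
Hypotheses (nsAU : (A <| U)%g) (abA : abelian A) (abUA : abelian (U / A)%g).

Local Notation V := (FiniteModule.fmod_of abUA).
Local Notation B := (FiniteModule.fmod_of abA).
Local Notation fmodA := (FiniteModule.fmod abA).

Let sAU : A \subset U. Proof. exact: normal_sub. Qed.
Let nAU : {subset U <= 'N(A)%g}. Proof. exact/subsetP/normal_norm. Qed.

Definition quo_class u : V := FiniteModule.fmod abUA (coset A u).
Definition quo_repr (v : V) : gT := repr (FiniteModule.fmval v).

Lemma quo_classM : {in U &, {morph quo_class : x y / (x * y)%g >-> x + y}}.
Proof.
by move=> x y Ux Uy; rewrite /quo_class morphM ?nAU // FiniteModule.fmodM ?mem_quotient.
Qed.

Lemma quo_class_id : {in A, forall a, quo_class a = 0}.
Proof. by move=> a Aa; rewrite /quo_class coset_id // FiniteModule.fmod1. Qed.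

Lemma quo_reprK v : quo_class (quo_repr v) = v.
Proof. by rewrite /quo_class coset_reprK FiniteModule.fmvalK. Qed.

Lemma quo_repr_in v : quo_repr v \in U.
Proof.
rewrite -(quotientGK nsAU) inE repr_coset_norm /= inE coset_reprK.
exact: FiniteModule.fmodP.
Qed.

Lemma quo_class_eq : {in U &, forall x y, quo_class x = quo_class y -> (x * y^-1)%g \in A}.
Proof.
move=> x y Ux Uy /(congr1 (@FiniteModule.fmval _ _ _)).
rewrite ![X in X = _]FiniteModule.fmodK ?[RHS]FiniteModule.fmodK ?mem_quotient // => eq_xy.
by rewrite -mem_rcoset; apply/rcoset_kercosetP; rewrite ?nAU.
Qed.

Definition transfer_factor u (v : V) : gT :=
  (quo_repr v * u * (quo_repr (v + quo_class u))^-1)%g.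

Lemma transfer_factor_in u v : u \in U -> transfer_factor u v \in A.
Proof.
move=> Uu; apply: quo_class_eq; rewrite ?groupM ?quo_repr_in //.
by rewrite quo_reprK quo_classM ?quo_repr_in // quo_reprK.
Qed.

Lemma VerE u : u \in U ->
  @Ver gT U A abA u = FiniteModule.fmval (\sum_v fmodA (transfer_factor u v)).
Proof.
move=> Uu; rewrite /Ver /transfer.
pose coset_set (v : V) : {set gT} := FiniteModule.fmval v.
have coset_setE x : x \in U -> coset_set (quo_class x) = (A :* x)%g.
  move=> Ux; rewrite /coset_set /quo_class FiniteModule.fmodK ?mem_quotient //.
  exact/val_coset/nAU.
have Us v := quo_repr_in v.
(* The library sums over right cosets of A as sets; these are matched with the elements of V. *)
rewrite (reindex_onto coset_set (fun X => quo_class (repr X))) /=; last first.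
  move=> _ /rcosetsP[x Ux ->]; case: repr_rcosetP => a Aa.
  by rewrite coset_setE ?groupM ?(subsetP sAU a) // rcosetM rcoset_id.
rewrite !FiniteModule.fmval_sum; apply: eq_big => [v | v _].
  by rewrite quo_reprK eqxx andbT -(quo_reprK v) coset_setE // -rcosetE imset_f.
have -> : (coset_set v :* u = coset_set (v + quo_class u))%g.
  by rewrite -{1 2}(quo_reprK v) -quo_classM // !coset_setE ?groupM // rcosetM.
have Af := transfer_factor_in v Uu.
rewrite /coset_set -/(quo_repr v) -/(quo_repr _) -/(transfer_factor u v) /restrm /=.
by rewrite [RHS]FiniteModule.fmodK // FiniteModule.fmodK //= morphim_idm.
Qed.

Definition transfer_cocycle u : coind V B := [ffun v => fmodA (transfer_factor u v)].

(** With t the chosen representatives, insert the inverse of t at v + [x], followed by t itself,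
    between x and y in the factor of xy. *)
Lemma transfer_cocycleM : {in U &, forall x y,
  transfer_cocycle (x * y)%g = transfer_cocycle x + gr_delta (quo_class x) *: transfer_cocycle y}.
Proof.
move=> x y Ux Uy; apply/ffunP=> v; rewrite 2!ffunE.
rewrite coind_deltaE !ffunE -FiniteModule.fmodM ?transfer_factor_in //.
by congr fmodA; rewrite /transfer_factor quo_classM // addrA !mulgA mulgKV.
Qed.

Variable gam : {morphism U >-> gT}.
Hypothesis gam_quo : {in U, forall u, (gam u * u^-1)%g \in A}.

Local Notation M := (coind V B * (group_ring V)^o)%type.

Let gamA : {in A, forall a, gam a \in A}.
Proof. by move=> a Aa; rewrite -(mulgKV a (gam a)) groupM ?gam_quo // (subsetP sAU). Qed.

Definition gam_fmod (b : B) : B := fmodA (gam (FiniteModule.fmval b)).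

Fact gam_fmod_additive : zmod_morphism gam_fmod.
Proof.
move=> b c; rewrite /gam_fmod; have [Ab Ac] := (FiniteModule.fmodP b, FiniteModule.fmodP c).
rewrite -FiniteModule.fmodV -FiniteModule.fmodM ?groupV ?gamA //.
by rewrite -morphV ?(subsetP sAU) // -morphM ?groupV ?(subsetP sAU).
Qed.

HB.instance Definition _ := GRing.isZmodMorphism.Build B B gam_fmod gam_fmod_additive.

Definition gam_shift : coind V B := [ffun v => fmodA (gam (quo_repr v) * (quo_repr v)^-1)%g].

(* The S-submodule of Map(V, A) x S generated by the values of splitting_cocycle is the Artin
   splitting module of U. Applying gam pointwise to transfer_cocycle u moves the representatives
   used in its definition; the term in gam_shift corrects this, so that adding the identity to
   gam_sub1 sends splitting_cocycle u to splitting_cocycle (gam u). *)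
Definition gam_sub1 (x : M) : M :=
  ([ffun v => gam_fmod (x.1 v) - x.1 v] + (x.2 : group_ring V) *: gam_shift, 0).

Fact gam_sub1_linear : linear gam_sub1.
Proof.
move=> r [f a] [h b]; congr pair; last by rewrite /= scaler0 addr0.
rewrite /= scalerDl -scalerA scalerDr addrACA; congr (_ + _).
apply/ffunP=> v; rewrite !ffunE /= [gam_fmod _]raddfD opprD addrACA; congr (_ + _).
rewrite raddf_sum -sumrB; apply: eq_bigr => w _.
by rewrite !ffunE raddfMz mulrzBl.
Qed.

HB.instance Definition _ :=
  GRing.isLinear.Build (group_ring V) M M *:%R gam_sub1 gam_sub1_linear.

(** The first coordinate carries the transfer; the second gives the projection to the augmentation
    ideal. *)
Definition splitting_cocycle u : M := (transfer_cocycle u, gr_delta (quo_class u) - 1).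

Lemma splitting_cocycleM : {in U &, forall x y, splitting_cocycle (x * y)%g =
  splitting_cocycle x + gr_delta (quo_class x) *: splitting_cocycle y}.
Proof.
move=> x y Ux Uy; congr pair; first exact: transfer_cocycleM.
rewrite quo_classM // gr_deltaD; set a := gr_delta _; set b := gr_delta _.
by change (a * b - 1 = a - 1 + a * (b - 1)); rewrite mulrBr mulr1 [RHS]addrC addrA subrK.
Qed.

Lemma gam_sub1_cocycle : {in U, forall u,
  gam_sub1 (splitting_cocycle u) = splitting_cocycle (gam u * u^-1)%g}.
Proof.
move=> u Uu; have Aa := gam_quo Uu; congr pair; last first.
  by rewrite quo_class_id // gr_delta0 subrr.
have Es v : gam_fmod (fmodA (transfer_factor u v)) = fmodA (gam (transfer_factor u v)).
  by rewrite /gam_fmod FiniteModule.fmodK ?transfer_factor_in.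
apply/ffunP=> v; rewrite /= scalerBl scale1r.
transitivity (gam_fmod (transfer_cocycle u v) - transfer_cocycle u v
   + (gam_shift (v + quo_class u) - gam_shift v)).
  rewrite -coind_deltaE [LHS]ffunE [X in X + _]ffunE; congr (_ + _).
  by rewrite ffunE [X in _ + X]ffunE.
rewrite /transfer_cocycle /gam_shift !ffunE Es.
have Uv w : quo_repr w \in U := quo_repr_in w.
have Ut w : transfer_factor u w \in U by rewrite (subsetP sAU) ?transfer_factor_in.
have As w := gam_quo (Uv w).
have At : gam (transfer_factor u v) \in A by rewrite gamA ?transfer_factor_in.
(* A is abelian, so the additive expression may be read as a product in any order; this one
   telescopes to t_v gamma(u) u^-1 t_v^-1, the factor of gamma(u) u^-1 at v. *)
have fmodE a b c d : a \in A -> b \in A -> c \in A -> d \in A ->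
    fmodA c - fmodA d + (fmodA b - fmodA a) = fmodA (a^-1 * c * b * d^-1)%g.
  move=> ? ? ? ?; rewrite addrA addrC !addrA addrAC -!FiniteModule.fmodV.
  by rewrite -!FiniteModule.fmodM ?groupM ?groupV.
rewrite fmodE ?As ?transfer_factor_in //.
congr fmodA; rewrite /transfer_factor [quo_class (gam u * _)%g]quo_class_id // addr0.
rewrite !morphM ?morphV ?groupM ?groupV //.
by rewrite !(invMg, invgK, mulgA) !(mulgKV, mulgK).
Qed.

Lemma transfer_trivial u : A :=: << U^`(1) :|: [set gam u * u^-1 | u in U] >>%g ->
  u \in U -> (gam u * u^-1)%g \in U^`(1)%g -> @Ver gT U A abA u = 1%g.
Proof.
move=> defA Uu fix_u.
have sU'A : U^`(1)%g \subset A by rewrite defA sub_gen ?subsetUl.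
have [n [g [m [genU gmA prod_m]]]] := exists_generators_index nsAU abUA.
have card_V : #|(V : finZmodType)| = #|(U / A)%g|.
  by rewrite card_sub.
rewrite -card_V in prod_m.
have norm0 : gr_norm V *: splitting_cocycle u = 0.
  apply: (@norm_fixed gT U A V M gam_sub1 snd quo_class splitting_cocycle gam)
    genU gmA prod_m _ Uu fix_u => //.
  - exact: quo_classM.
  - exact: quo_class_id.
  - by move=> v; exists (quo_repr v); [exact: quo_repr_in | exact: quo_reprK].
  - exact: splitting_cocycleM.
  - exact: gam_sub1_cocycle.
(* The first coordinate of the norm multiple is a constant function with value the transfer of u; it
   is read off at 0. *)
have/(congr1 fst)/ffunP/(_ 0) := norm0; rewrite [LHS]coind_normE ffunE /=.
under eq_bigr => v _ do rewrite ffunE.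
by rewrite VerE // => ->.
Qed.

End Transfer.

Local Close Scope ring_scope.
Local Open Scope group_scope.

Theorem theorem10 (gT : finGroupType) (U A : {group gT})
  (nAU : A <| U) (abA : abelian A)
  (gam : {morphism U >-> gT}) (gamU : gam @* U \subset U)
  (sU'A : U^`(1) \subset A)
  (defA : A :=: << U^`(1) :|: [set gam u * u^-1 | u in U] >>) :
  forall u, u \in U -> coset U^`(1) (gam u) = coset U^`(1) u ->
    @Ver gT U A abA u = 1.
Proof.
move=> u Uu fix_u; have abUA := sub_der1_abelian sU'A.
apply: (@transfer_trivial _ _ _ nAU abA abUA gam) => //.
  by move=> x Ux; rewrite defA mem_gen //; apply/setUP; right; apply/imsetP; exists x.
(* Equality of the [coset] images gives membership in U' only inside the normaliser of U'; [gamU]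
   places gamma(u) there. *)
rewrite -mem_rcoset.
have sN x : x \in U -> x \in 'N(U^`(1)) by apply/subsetP/normal_norm/der_normal.
apply/rcoset_kercosetP; rewrite ?sN //.
by apply: (subsetP gamU); rewrite mem_morphim.
Qed.
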